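(* There are infinitely many $2$-connected $3$-regular graphs $H$ such that, writing $n$ for the number of vertices of $H$, the path cover number satisfies $p(H) \ge n/14$.
   Context: Graphs are finite and simple. A path cover of a graph $G$ is a set of pairwise vertex-disjoint paths in $G$ such that every vertex of $G$ lies on one of the paths (a single vertex counts as a path). The path cover number $p(G)$ is the minimum number of paths in a path cover of $G$. *)

(* Defs.v *)
From HB Require Import structures.
From mathcomp Require Import all_boot all_order all_algebra.

Set Implicit Arguments.
Unset Strict Implicit.
Unset Printing Implicit Defensive.

Record sgraph := SGraph {
  vertex :> finType;
  adj : rel vertex;
  adj_sym : symmetric adj;
  adj_irrefl : irreflexive adj
}.

Definition isomorphic (G H : sgraph) : Prop :=
  exists2 f : G -> H, bijective f & forall x y, adj (f x) (f y) = adj x y.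

Definition degree (G : sgraph) (x : G) : nat := #|[set y | adj x y]|.

Definition regular (k : nat) (G : sgraph) : bool :=
  [forall x : G, degree x == k].

Definition connected_on (G : sgraph) (A : {set G}) : bool :=
  [forall x in A, forall y in A,
     connect [rel u v | [&& u \in A, v \in A & adj u v]] x y].

Definition k_connected (k : nat) (G : sgraph) : bool :=
  (k < #|G|) && [forall X : {set G}, (#|X| < k) ==> connected_on (~: X)].

Section PathCover.
Variable G : sgraph.

(* A path is given by its sequence of vertices. No path has more than #|G|
   vertices, so the bounded sequences below lose nothing and form a finType.
   The two orientations of a path are different sequences; they share vertices,
   so a path cover contains at most one of them. *)
Definition is_path (p : #|G|.-bseq G) : bool :=
  [&& 0 < size p, uniq p & sorted (@adj G) p].

Definition path_cover (P : {set #|G|.-bseq G}) : bool :=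
  [&& [forall p in P, is_path p],
      [forall p in P, forall q in P, (p != q) ==> [disjoint p & q]] &
      [forall x : G, exists p in P, x \in p]].

Lemma singleton_bseq_subproof (x : G) : size [:: x] <= #|G|.
Proof. by apply/card_gt0P; exists x. Qed.

Definition singleton_path (x : G) : #|G|.-bseq G :=
  Bseq (singleton_bseq_subproof x).

Definition trivial_cover : {set #|G|.-bseq G} := [set singleton_path x | x : G].

Lemma trivial_coverP : path_cover trivial_cover.
Proof.
apply/and3P; split.
- by apply/forall_inP => _ /imsetP[x _ ->].
- apply/forall_inP => _ /imsetP[x _ ->].
  apply/forall_inP => _ /imsetP[y _ ->]; apply/implyP => nxy.
  rewrite disjoint_subset; apply/subsetP => z; rewrite !inE => /eqP ->.
  by apply: contra nxy => /eqP ->.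
- apply/forallP => x; apply/exists_inP; exists (singleton_path x).
    exact: imset_f.
  exact: (mem_head x [::]).
Qed.

Definition path_cover_number : nat :=
  #|[arg min_(P < trivial_cover | path_cover P) #|P|]|.

Lemma path_cover_numberP :
  (exists2 P, path_cover P & #|P| = path_cover_number) /\
  (forall P, path_cover P -> path_cover_number <= #|P|).
Proof.
rewrite /path_cover_number; case: arg_minnP => [|P cP minP].
  exact: trivial_coverP.
by split=> //; exists P.
Qed.

End PathCover.

(* Main.v *)
Require Import Defs.
From mathcomp Require Import all_boot all_order all_algebra.

(** Replace every edge of a 3-regular 2-connected multigraph on [2m] vertices by
    a path through a copy of [K4] minus an edge. The result has
    [2m + 4 * 3m = 14m] vertices, and deleting the [2m] old vertices leaves [3m]
    components. A path with [k] old vertices meets at most [k + 1] components,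
    so a path cover has at least [3m - 2m = m] paths. The multigraph used here
    is a cycle of length [2m] with every other edge doubled. *)

Set Implicit Arguments.
Unset Strict Implicit.
Unset Printing Implicit Defensive.

(** * 2-connectedness from an st-numbering *)

Section StNumbering.
Variables (G : sgraph) (X : {set G}).

Let induced := [rel u v : G | [&& u \in ~: X, v \in ~: X & adj u v]].

(** Each step of the walk goes below [r x], hence below [r] on all of [X], so the walk avoids [X];
    strict descent can only stop at [s]. *)
Lemma connect_descent (r : G -> nat) (s x : G) :
  (forall y, y != s -> exists2 z, adj y z & r z < r y) ->
  x \notin X -> {in X, forall z, r x <= r z} ->
  s \notin X /\ connect induced x s.
Proof.
move=> descend; have [n] := ubnP (r x).
elim: n x => // n IHn x lt_x_n Xx minx.
have [<-|/descend[y xy lt_yx]] := eqVneq x s; first by split.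
have Xy : y \notin X.
  by apply: contraL lt_yx => /minx; rewrite -leqNgt.
have [||Xs con_ys] := IHn y _ Xy.
- exact: leq_trans lt_yx lt_x_n.
- by move=> z /minx; apply: leq_trans (ltnW lt_yx).
split=> //; apply: connect_trans con_ys; apply: connect1.
by rewrite /= !inE Xx Xy.
Qed.

End StNumbering.

(* If [z] is deleted, a vertex numbered above [z] climbs to [t] and one numbered
   below [z] descends to [s], and neither walk meets [z]. *)
Lemma st_numbering_2_connected (G : sgraph) (r : G -> nat) (s t : G) :
  2 < #|G| -> adj s t ->
  (forall x, x != s -> exists2 y, adj x y & r y < r x) ->
  (forall x, x != t -> exists2 y, adj x y & r x < r y) ->
  k_connected 2 G.
Proof.
move=> G_gt2 st descend climb; rewrite /k_connected G_gt2 /=.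
apply/forallP => X; apply/implyP; rewrite ltnS => /card_le1_eqP X_le1.
set e := [rel u v : G | [&& u \in ~: X, v \in ~: X & adj u v]].
have e_sym : connect_sym e.
  by apply: sym_connect_sym => u v /=; rewrite andbCA adj_sym.
(* The reversed numbering [N - r] turns climbing to [t] into a descent. *)
pose N := \max_x r x; have le_rN x : r x <= N by apply: leq_bigmax.
have climb' x : x != t -> exists2 y, adj x y & N - r y < N - r x.
  move=> /climb[y xy lt_xy]; exists y => //.
  by apply: ltn_sub2l => //; apply: leq_trans (le_rN y).
have to_st x : x \notin X ->
    s \notin X /\ connect e x s \/ t \notin X /\ connect e x t.
  move=> Xx; have [/forall_inP le_x|] := boolP [forall z in X, r x <= r z].
    by left; apply: connect_descent descend Xx le_x.
  rewrite negb_forall_in => /exists_inP[z Xz]; rewrite -ltnNge => lt_zx.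
  right; apply: (connect_descent climb' Xx) => w Xw.
  by rewrite (X_le1 _ _ Xz Xw) leq_sub2l // ltnW.
have con_st : s \notin X -> t \notin X -> connect e s t.
  by move=> Xs Xt; apply: connect1; rewrite /= !inE Xs Xt.
apply/forall_inP => x; rewrite inE => /to_st con_x.
apply/forall_inP => y; rewrite inE => /to_st con_y.
case: con_x => -[X1 con_x]; case: con_y => -[X2 con_y];
  apply: connect_trans con_x _; rewrite e_sym; apply: connect_trans con_y _ => //.
  by rewrite e_sym con_st.
exact: con_st.
Qed.

(** * Path covers and deleted vertices *)

Section PathCoverBound.
Variables (G : sgraph) (C : finType) (S : pred G) (f : G -> C).
(* [f] is constant on each component of [G] minus [S]. *)
Hypothesis f_adj : forall x y, adj x y -> ~~ S x -> ~~ S y -> f x = f y.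

(** A maximal run of vertices outside [S] has a single class and is charged to the [S]-vertex just
    before it. Only a run at the start of the path has none, whence the term [~~ S x]. *)
Lemma card_path_classes (x : G) (p : seq G) : path (@adj G) x p ->
  #|[set f y | y in x :: p & ~~ S y]| <= count S (x :: p) + ~~ S x.
Proof.
elim: p x => [|y p IHp] x /=.
  move=> _; have [Sx|Sx] := boolP (S x); last first.
    rewrite /= !add0n -(cards1 (f x)) subset_leq_card //.
    apply/subsetP => _ /imsetP[y + ->]; rewrite !inE => /andP[/eqP-> _].
    by rewrite eqxx.
  rewrite (_ : [set _ | _ in _ & _] = set0) ?cards0 //.
  apply/setP => c; rewrite inE; apply/negbTE/imsetP => -[y + _].
  by rewrite !inE => /andP[/eqP->]; rewrite Sx.
case/andP => xy /IHp IH.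
have sub (A : {set C}) : [set f z | z in y :: p & ~~ S z] \subset A ->
    (~~ S x -> f x \in A) -> [set f z | z in [:: x, y & p] & ~~ S z] \subset A.
  move=> /subsetP subA fxA; apply/subsetP => _ /imsetP[z + ->].
  rewrite inE => /andP[]; rewrite inE => /orP[/eqP->//|yp_z Sz].
  by apply: subA; apply/imsetP; exists z; rewrite // inE yp_z.
have [Sx|Sx] := boolP (S x).
  have le := subset_leq_card (sub _ (subxx _) (fun H => False_ind _ (negP H Sx))).
  apply: leq_trans le (leq_trans IH _).
  by rewrite addn0 addnC leq_add2r; case: (S y).
have [Sy|Sy] := boolP (S y).
  (* The class of [x] may be new and is paid for by [~~ S x]; since [y] is in [S], the bound for the
     tail has no extra term. *)
  apply: leq_trans (subset_leq_card (sub (f x |: _) (subsetUr _ _) _)) _.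
    by rewrite setU11.
  rewrite cardsU1 addnC leq_add ?leq_b1 //.
  by apply: leq_trans IH _; rewrite /= Sy addn0.
have fx_in : f x \in [set f z | z in y :: p & ~~ S z].
  rewrite (f_adj xy Sx Sy); apply/imsetP; exists y => //.
  by rewrite inE mem_head.
apply: leq_trans (subset_leq_card (sub _ (subxx _) (fun=> fx_in))) _.
by apply: leq_trans IH _; rewrite /= (negbTE Sy).
Qed.

Lemma card_classes_le_path_cover (P : {set #|G|.-bseq G}) :
  (forall c, exists2 x, ~~ S x & f x = c) ->
  path_cover P -> #|C| <= #|S| + #|P|.
Proof.
move=> f_surj /and3P[/forall_inP P_path /forall_inP P_disj /forallP P_cov].
pose A (p : #|G|.-bseq G) := [set f y | y in p & ~~ S y].
have cardA p : p \in P -> #|A p| <= \sum_(x | S x) (x \in p) + 1.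
  case: p => -[|x s] le_s /P_path/and3P[] //= _ Us xs.
  have -> : \sum_(y | S y) (y \in x :: s) = count S (x :: s).
    rewrite -size_filter -(card_uniqP (filter_uniq S (Us : uniq (x :: s)))).
    rewrite -sum1_card (eq_bigl _ _ (mem_filter S ^~ _)) big_mkcondr.
    by apply: eq_bigr => y _; case: (y \in _).
  by apply: leq_trans (card_path_classes xs) _; rewrite leq_add2l leq_b1.
have -> : #|C| = #|\bigcup_(p in P) A p|.
  rewrite -cardsT; congr #|pred_of_set _|; apply/setP => c; rewrite inE; symmetry.
  have [x Sx <-] := f_surj c; have /exists_inP[p Pp px] := P_cov x.
  apply/bigcupP; exists p => //; apply/imsetP; exists x => //.
  by rewrite inE px.
have le_cup : #|\bigcup_(p in P) A p| <= \sum_(p in P) #|A p|.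
  elim/big_rec2: _ => [|p n B _ le_Bn]; first by rewrite cards0.
  by apply: leq_trans (leq_card_setU _ _) _; rewrite leq_add2l.
apply: leq_trans le_cup (leq_trans (leq_sum _ cardA) _).
rewrite big_split /= sum1_card leq_add2r.
(* Counted by vertices instead of paths: by disjointness each vertex of [S] lies on at most one
   path. *)
rewrite exchange_big /= -[leqRHS]sum1_card leq_sum // => x Sx.
have -> : \sum_(p in P) (x \in p) = #|[set p in P | x \in p]|.
  rewrite -sum1dep_card big_mkcondr /=.
  by apply: eq_bigr => p _; case: (x \in p).
apply/card_le1_eqP => p q.
rewrite !inE => /andP[Pp px] /andP[Pq qx].
have /forall_inP/(_ q Pq) := P_disj p Pp; have [//|_ /=] := eqVneq p q.
by move=> /pred0P/(_ x); rewrite /= px qx.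
Qed.

End PathCoverBound.

(** * The necklace graphs *)

(* One block: [0] and [9] are old vertices, joined by two copies of [K4] minus an
   edge on [1..4] and [5..8]; a third copy on [10..13] leads from [9] to vertex
   [0] of the next block. *)
Definition block_edges : seq (nat * nat) :=
  [:: (0, 1); (0, 5);
      (1, 2); (1, 3); (2, 3); (2, 4); (3, 4); (4, 9);
      (5, 6); (5, 7); (6, 7); (6, 8); (7, 8); (8, 9);
      (9, 10); (10, 11); (10, 12); (11, 12); (11, 13); (12, 13)].

Definition block_adj (k l : nat) : bool :=
  ((k, l) \in block_edges) || ((l, k) \in block_edges).

Definition block_old (k : nat) : bool := k \in [:: 0; 9].

(** Numbers the three copies of [K4] minus an edge; the old positions 0 and 9 get the default values
    0 and 2. *)
Definition block_class (k : nat) : nat :=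
  if k < 5 then 0 else if k < 9 then 1 else 2.

(** The list form evaluates, so checks on a block become boolean computations. *)
Lemma all_ord14 (Q : pred nat) : all Q (iota 0 14) -> forall k : 'I_14, Q k.
Proof. by move=> /allP allQ k; apply: allQ; rewrite mem_iota ltn_ord. Qed.

Lemma has_ord14 (Q : pred nat) : has Q (iota 0 14) -> exists k : 'I_14, Q k.
Proof.
move=> /hasP[k]; rewrite mem_iota => /andP[_ lt_k] Qk.
by exists (Ordinal (lt_k : k < 14)).
Qed.

Lemma card_ord14 (Q : pred nat) :
  #|[set k : 'I_14 | Q k]| = count Q (iota 0 14).
Proof.
by rewrite cardsE cardE size_filter -val_enum_ord count_map enumT.
Qed.

Section Necklace.
Variable m : nat.

(** [ordS] is the cyclic successor, so the last block is joined to the first; for [m = 1] the only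
    block closes on itself. *)
Definition necklace_adj (x y : 'I_m * 'I_14) : bool :=
  [|| (x.1 == y.1) && block_adj x.2 y.2,
      [&& x.2 == 13 :> nat, y.2 == 0 :> nat & y.1 == ordS x.1] |
      [&& y.2 == 13 :> nat, x.2 == 0 :> nat & x.1 == ordS y.1]].

Lemma necklace_adj_sym : symmetric necklace_adj.
Proof.
move=> x y; rewrite /necklace_adj /block_adj eq_sym.
by congr (_ && _ || _); rewrite orbC.
Qed.

Lemma necklace_adj_irrefl : irreflexive necklace_adj.
Proof.
move=> [i k]; rewrite /necklace_adj /= eqxx /=.
have := @all_ord14 (fun k => ~~ block_adj k k) isT k => /negbTE->.
by case: eqVneq => [->|].
Qed.

Definition necklace := SGraph necklace_adj_sym necklace_adj_irrefl.

Lemma card_necklace : #|necklace| = m * 14.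
Proof. by rewrite card_prod !card_ord. Qed.

Lemma necklace_regular : regular 3 necklace.
Proof.
apply/forallP => -[i k]; rewrite /degree.
have -> : [set y | @adj necklace (i, k) y] =
    [set (i, l) | l in [set l : 'I_14 | block_adj k l]] :|:
    ([set y | (k == 13 :> nat) && (y == (ordS i, ord0))] :|:
     [set y | (k == 0 :> nat) && (y == (ord_pred i, ord_max))]).
  apply/setP => -[j l]; rewrite !inE /= /necklace_adj /= -!pair_eqE /=.
  congr [|| _, _ | _].
  - apply/andP/imsetP => [[/eqP<- kl]|[l' + [-> ->]]].
      by exists l; rewrite ?inE.
    by rewrite inE.
  - by congr (_ && _); rewrite andbC.
  - rewrite andbCA; congr (_ && _); rewrite andbC; congr (_ && _).
    by rewrite eq_sym (can2_eq (@ordSK m) (@ord_predK m)).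
(* Positions 0 and 13 are not adjacent inside a block, so a linking edge is never counted twice,
   even when [m = 1]. *)
rewrite cardsU disjoint_setI0 ?cards0; last first.
  rewrite disjoint_subset; apply/subsetP => _ /imsetP[l + ->].
  rewrite !inE -!pair_eqE /= => kl; apply/norP; split; apply: contraTN kl.
    by move=> /and3P[/eqP-> _ /eqP->].
  by move=> /and3P[/eqP-> _ /eqP->].
rewrite subn0 card_imset; last by move=> l l' [].
rewrite cardsU disjoint_setI0 ?cards0; last first.
  rewrite disjoint_subset; apply/subsetP => y; rewrite !inE.
  by move=> /andP[/eqP->].
have card_if (b : bool) (z : necklace) : #|[set y | b && (y == z)]| = b.
  case: b => /=; first by apply: etrans (cards1 z); apply: eq_card => y; rewrite !inE.
  by apply: etrans (cards0 necklace); apply: eq_card => y; rewrite !inE.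
rewrite subn0 !card_if card_ord14.
exact: (@all_ord14 (fun k => count (block_adj k) (iota 0 14) +
  ((k == 13) + (k == 0)) == 3)).
Qed.

Definition necklace_old (x : necklace) : bool := block_old x.2.

Definition necklace_class (x : necklace) : 'I_m * 'I_3 :=
  (x.1, inord (block_class x.2)).

Lemma necklace_class_adj (x y : necklace) :
  adj x y -> ~~ necklace_old x -> ~~ necklace_old y ->
  necklace_class x = necklace_class y.
Proof.
move: x y => [i k] [j l]; rewrite /necklace_old /necklace_class /=.
case/or3P => /=.
- move=> /andP[/eqP<- kl] old_k old_l; congr (_, inord _).
  have := @all_ord14 (fun k => all (fun l => [&& block_adj k l, ~~ block_old k &
    ~~ block_old l] ==> (block_class k == block_class l)) (iota 0 14)) isT k.
  by move=> /all_ord14/(_ l)/implyP/(_ _)/eqP; apply; rewrite kl old_k.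
(* An edge between blocks ends at a position 0, which is old. *)
- by move=> /and3P[_ /eqP->].
- by move=> /and3P[_ /eqP->].
Qed.

Lemma necklace_class_surj (c : 'I_m * 'I_3) :
  exists2 x, ~~ necklace_old x & necklace_class x = c.
Proof.
case: c => i h; have := @allP _ (fun h =>
  has (fun k => ~~ block_old k && (block_class k == h)) (iota 0 14))
  (iota 0 3) isT h.
rewrite mem_iota ltn_ord => /(_ isT)/has_ord14[k /andP[old_k /eqP class_k]].
by exists (i, k) => //; rewrite /necklace_class /= class_k inord_val.
Qed.

Lemma card_necklace_old : #|necklace_old| = m * 2.
Proof.
have -> : #|necklace_old| = #|setX [set: 'I_m] [set k : 'I_14 | block_old k]|.
  by apply: eq_card => -[i k]; rewrite !inE.
by rewrite cardsX cardsT card_ord card_ord14.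
Qed.

Lemma necklace_path_cover_number : m <= path_cover_number necklace.
Proof.
have [[P cover_P <-] _] := path_cover_numberP necklace.
have := card_classes_le_path_cover necklace_class_adj necklace_class_surj cover_P.
by rewrite card_necklace_old card_prod !card_ord (mulnDr m 2 1) leq_add2l muln1.
Qed.

End Necklace.

(** Reading the blocks in order is an st-numbering: its first and last vertices are joined by the
    edge closing the cycle. Inside a block only position 0 lacks a smaller neighbour and only 13 a
    larger one; there the linking edges serve. *)
Lemma necklace_2_connected m : k_connected 2 (necklace m.+1).
Proof.
pose r (x : necklace m.+1) := x.1 * 14 + x.2.
apply: (@st_numbering_2_connected _ r (ord0, ord0) (ord_max, ord_max)).
- by rewrite card_necklace mulSn.
- by rewrite /= /necklace_adj /=; apply/orP; right; rewrite -val_eqE /= modnn.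
- move=> [i k] neq0; have [k0|k_neq0] := eqVneq (k : nat) 0.
    exists (ord_pred i, ord_max).
      by rewrite /= /necklace_adj /= k0 /= ord_predK eqxx !orbT.
    (* The predecessor block must not wrap around to the last one. *)
    have i_gt0 : 0 < i.
      rewrite lt0n; apply: contraNneq neq0 => i0.
      by rewrite -pair_eqE /= -!val_eqE /= i0 k0.
    rewrite /r /= k0 addn0 -[i in _ < i * _](prednK i_gt0).
    rewrite -{1}(prednK i_gt0) addSn /= modnDr modn_small; last first.
      exact: leq_ltn_trans (leq_pred _) (ltn_ord i).
    by rewrite mulSn addnC ltn_add2r.
  have := @all_ord14 (fun k => (k != 0) ==>
    has (fun l => block_adj k l && (l < k)) (iota 0 14)) isT k.
  rewrite k_neq0 => /has_ord14[l /andP[kl lt_lk]].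
  exists (i, l); first by rewrite /= /necklace_adj /= eqxx kl.
  by rewrite /r ltn_add2l.
- move=> [i k] neq_max; have [k13|k_neq13] := eqVneq (k : nat) 13.
    exists (ordS i, ord0).
      by rewrite /= /necklace_adj /= k13 /= eqxx !orbT.
    have lt_im : i.+1 < m.+1.
      rewrite ltnS ltn_neqAle -ltnS ltn_ord andbT.
      apply: contraNneq neq_max => im.
      by rewrite -pair_eqE /= -!val_eqE /= im k13 !eqxx.
    by rewrite /r /= k13 modn_small // mulSn addn0 addnC ltn_add2r.
  have := @all_ord14 (fun k => (k != 13) ==>
    has (fun l => block_adj k l && (k < l)) (iota 0 14)) isT k.
  rewrite k_neq13 => /has_ord14[l /andP[kl lt_kl]].
  exists (i, l); first by rewrite /= /necklace_adj /= eqxx kl.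
  by rewrite /r ltn_add2l.
Qed.

Theorem theorem1p2 :
  exists H : nat -> sgraph,
    (forall i j : nat, i <> j -> ~ isomorphic (H i) (H j)) /\
    (forall i : nat,
       [/\ k_connected 2 (H i),
           regular 3 (H i) &
           (#|H i|%:R / 14%:R <= (path_cover_number (H i))%:R :> rat)%R]).
Proof.
(* The shift avoids the empty graph; different indices give different numbers of vertices. *)
exists (fun i => necklace i.+1); split.
  move=> i j neq_ij [f bij_f _]; apply: neq_ij.
  have := bij_eq_card bij_f; rewrite !card_necklace => /eqP.
  by rewrite eqn_pmul2r // => /eqP[].
move=> i; split; first exact: necklace_2_connected.
  exact: necklace_regular.
rewrite card_necklace GRing.natrM GRing.mulfK // Num.Theory.ler_nat.
exact: necklace_path_cover_number.
Qed.
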